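(* For every real number $p\ge3$ and every integer $n\ge1$, $$\left(\sum_{i=1}^n i^{-1/p}\right)^{p-1}<\left(\frac{p}{p-1}\right)^p n^p\left(n^{-(p-1)/p}-(n+1)^{-(p-1)/p}\right).$$ *)

(* Defs.v *)
From Stdlib Require Import Reals.

(* Main.v *)
Require Import Defs.
From Stdlib Require Import Reals Lra Lia.
From Coquelicot Require Import Coquelicot.
Open Scope R_scope.

(** Write [a = 1 - 1/p] and [N = n]. Comparing the sum with an integral gives
    [S <= (N^a / a) (1 - N^(-a) / p)], and averaging the derivative gives
    [1 - (1 + 1/N)^(-a) >= (a / N) exp (- (a + 1) / (2 N))]. Extracting
    [(p-1)]-th roots and using [exp y >= 1 + y], the theorem reduces to
    [(a + 1) / (2 a) < N^(1/p)]. For [N >= 2] and [p >= 3] this follows from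
    [(5/4)^3 < 2] and Bernoulli's inequality; the case [N = 1] is treated apart. *)

Lemma Rpower_pos (x y : R) : 0 < Rpower x y.
Proof. apply exp_pos. Qed.

(** After taking logarithms this is [s * L < m]. Weighting the tangent bounds [e^y >= 1 + y] at
    [L - m] and [- m] by [s] and [1 - s] gives [1 + s * L - m < 1]. *)
Lemma Rpower_bernoulli_lt (x s : R) :
  -1 < x -> x <> 0 -> 0 < s < 1 -> Rpower (1 + x) s < 1 + s * x.
Proof.
  intros hx hx0 hs.
  assert (hM : 0 < 1 + s * x) by nra.
  rewrite <- (exp_ln (1 + s * x)) by exact hM.
  apply exp_increasing.
  set (m := ln (1 + s * x)).
  set (L := ln (1 + x)).
  (* This makes the tangent bound at [- m] strict, and its weight [1 - s] is positive. *)
  assert (hm : m <> 0).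
  { intro h.
    assert (e : exp m = 1 + s * x) by (apply exp_ln; exact hM).
    rewrite h, exp_0 in e.
    assert (e' : s * x = 0) by lra.
    apply Rmult_integral in e'. lra. }
  (* Tangent line bounds for the two terms of [s e^(L-m) + (1-s) e^(-m) = 1]. *)
  assert (h1 := exp_ineq1_le (L - m)).
  assert (h2 := exp_ineq1 (- m) ltac:(lra)).
  assert (key : s * exp (L - m) + (1 - s) * exp (- m) = 1).
  { unfold Rminus. rewrite exp_plus, exp_Ropp.
    unfold m, L. rewrite !exp_ln by lra. field. lra. }
  nra.
Qed.

Lemma Rpower_bernoulli_le (x s : R) :
  -1 < x -> 0 < s <= 1 -> Rpower (1 + x) s <= 1 + s * x.
Proof.
  intros hx [hs0 hs1].
  destruct (Req_dec x 0) as [->|hx0].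
  { unfold Rpower. rewrite Rplus_0_r, ln_1, Rmult_0_r, exp_0. lra. }
  destruct (Req_dec s 1) as [->|hs].
  { rewrite Rpower_1; lra. }
  left. apply Rpower_bernoulli_lt; lra.
Qed.

(** Right side minus left side vanishes at [x = 0], so by the mean value theorem a nonnegative
    derivative suffices. The exponent is the mean of [- (a + 1) * t] over [0 <= t <= x]. *)
Lemma one_minus_Rpower_ge (a x : R) :
  0 < a -> 0 < x ->
  a * x * exp (- ((a + 1) * x / 2)) <= 1 - Rpower (1 + x) (- a).
Proof.
  intros ha hx.
  set (f := fun t => 1 - exp (- a * ln (1 + t)) - a * t * exp (- ((a + 1) * t / 2))).
  set (f' := fun t => a * exp (- a * ln (1 + t)) * / (1 + t)
      - a * exp (- ((a + 1) * t / 2)) * (1 - (a + 1) * t / 2)).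
  assert (hd : forall c, 0 <= c <= x -> derivable_pt_lim f c (f' c)).
  { intros c hc. apply is_derive_Reals. unfold f, f'. auto_derive.
    - lra.
    - unfold Rdiv. field. lra. }
  destruct (MVT_cor2 f f' 0 x hx hd) as [c [hc1 hc2]].
  assert (h0 : f 0 = 0).
  { unfold f. rewrite Rplus_0_r, ln_1, Rmult_0_r, exp_0. ring. }
  enough (0 <= f x) by (unfold f in H; unfold Rpower; lra).
  enough (0 <= f' c) by (rewrite h0 in hc1; nra).
  unfold f'.
  set (z := (a + 1) * c / 2).
  (* [(1 + c)^(-a-1) >= e^(-2z) >= e^(-z) (1 - z)]. *)
  assert (e : exp (- a * ln (1 + c)) * / (1 + c) = exp (- (a + 1) * ln (1 + c))).
  { replace (- (a + 1) * ln (1 + c)) with (- a * ln (1 + c) + - ln (1 + c)) by ring.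
    rewrite exp_plus, (exp_Ropp (ln (1 + c))), exp_ln by lra. reflexivity. }
  assert (hl : ln (1 + c) <= c).
  { rewrite <- (ln_exp c) at 2. apply ln_le; [lra | apply exp_ineq1_le]. }
  assert (h1 : exp (- z + - z) <= exp (- (a + 1) * ln (1 + c))).
  { destruct (Rle_lt_or_eq_dec (- z + - z) (- (a + 1) * ln (1 + c))) as [h | ->];
      [unfold z; nra | left; apply exp_increasing; exact h | apply Rle_refl]. }
  assert (h2 := exp_ineq1_le (- z)).
  assert (h3 := exp_pos (- z)).
  rewrite exp_plus in h1.
  rewrite Rmult_assoc, e.
  assert (exp (- z) * (1 - z) <= exp (- z) * exp (- z)) by (apply Rmult_le_compat_l; lra).
  nra.
Qed.

(** The bound equals [1] plus the integral of [t^(-s)] from [1] to [m + 1]. Keeping the first term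
    exact produces the [- s] in the numerator, which the final estimate needs. *)
Lemma sum_Rpower_le (s : R) (m : nat) :
  0 < s < 1 ->
  sum_f_R0 (fun i => Rpower (INR (i + 1)) (- s)) m
  <= (Rpower (INR (m + 1)) (1 - s) - s) / (1 - s).
Proof.
  intros hs. induction m as [|m IH].
  - simpl. unfold Rpower. rewrite ln_1, !Rmult_0_r, exp_0.
    right. field. lra.
  - rewrite tech5.
    replace (S m + 1)%nat with (S (m + 1)) by lia.
    assert (hM : 0 < INR (m + 1)) by (apply lt_0_INR; lia).
    rewrite S_INR. set (M := INR (m + 1)) in *.
    set (P := Rpower (M + 1) (1 - s)).
    assert (hi : 0 < / (M + 1) < 1).
    { split; [apply Rinv_0_lt_compat; lra|].
      rewrite <- Rinv_1. apply Rinv_lt_contravar; lra. }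
    assert (e1 : Rpower (M + 1) (- s) = P * / (M + 1)).
    { unfold P, Rminus. rewrite Rpower_plus, Rpower_1 by lra. field. lra. }
    assert (e2 : Rpower M (1 - s) = P * Rpower (1 + - / (M + 1)) (1 - s)).
    { unfold P. rewrite Rpower_mult_distr by lra. f_equal. field. lra. }
    (* Multiplied by [P], this reads [(1 - s) (M+1)^(-s) <= (M+1)^(1-s) - M^(1-s)]: the new term is
       at most its integral. *)
    assert (hb := Rpower_bernoulli_le (- / (M + 1)) (1 - s) ltac:(lra) ltac:(lra)).
    assert (hP : 0 < P) by apply Rpower_pos.
    assert (hstep : Rpower M (1 - s) <= P * (1 - (1 - s) * / (M + 1))).
    { rewrite e2. apply Rmult_le_compat_l; lra. }
    rewrite e1.
    apply Rmult_le_reg_r with (1 - s); [lra|].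
    apply (Rmult_le_compat_r (1 - s)) in IH; [|lra].
    unfold Rdiv in *. rewrite Rmult_assoc, Rinv_l in * by lra.
    lra.
Qed.

(** With [s = 1/p] the left side is [(a + 1) / (2 a)], so this is the reduced inequality at
    [N = 2]. *)
Lemma Rpower_2_gt (s : R) :
  0 < s <= 1 / 3 -> (2 - s) / (2 * (1 - s)) < Rpower 2 s.
Proof.
  intros hs.
  assert (h1 : Rpower (5 / 4) (3 * s) < Rpower 2 s).
  { rewrite <- Rpower_mult.
    replace 3 with (INR 3) by (simpl; ring). rewrite Rpower_pow by lra.
    apply Rlt_Rpower_l; simpl; lra. }
  eapply Rle_lt_trans; [|exact h1].
  (* Bernoulli bounds powers from above, so it is applied to the reciprocal [4/5]; the exponent
     [3 * s] is at most [1]. *)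
  assert (hb := Rpower_bernoulli_le (- (1 / 5)) (3 * s) ltac:(lra) ltac:(lra)).
  assert (e : Rpower (5 / 4) (3 * s) * Rpower (1 + - (1 / 5)) (3 * s) = 1).
  { rewrite Rpower_mult_distr by lra.
    replace (5 / 4 * (1 + - (1 / 5))) with 1 by field.
    unfold Rpower. rewrite ln_1, Rmult_0_r. apply exp_0. }
  assert (hp := Rpower_pos (5 / 4) (3 * s)).
  set (A := Rpower (5 / 4) (3 * s)) in *.
  assert (h2 : 1 <= A * (1 - 3 * s / 5)).
  { rewrite <- e at 1. apply Rmult_le_compat_l; lra. }
  assert (h3 : 5 / (5 - 3 * s) <= A).
  { apply Rmult_le_reg_r with (5 - 3 * s); [lra|].
    unfold Rdiv. rewrite Rmult_assoc, Rinv_l by lra. lra. }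
  eapply Rle_trans; [|exact h3].
  (* Cleared of denominators, the claim is [3 s^2 <= s], with equality at [s = 1/3]. *)
  apply Rmult_le_reg_r with ((5 - 3 * s) * (2 * (1 - s))); [nra|].
  field_simplify; nra.
Qed.

(** This is the case [n = 1], where [(a + 1) / (2 a) < N^(1/p)] fails. With [r = p/(p-1)], Bernoulli
    gives both [r^(p-1) >= 2] and [r (1 - 2^(1/p) / 2) > 1/2]. *)
Lemma Rpower_one_minus_inv_lt (p : R) :
  3 <= p ->
  1 < Rpower (p / (p - 1)) p * (1 - Rpower 2 (- ((p - 1) / p))).
Proof.
  intros hp.
  assert (hip : 0 < 1 / p < 1).
  { split; [apply Rdiv_lt_0_compat; lra|]. apply (proj1 (Rdiv_lt_1 1 p ltac:(lra))). lra. }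
  assert (hiq : 0 < / (p - 1) <= 1).
  { split; [apply Rinv_0_lt_compat; lra|].
    rewrite <- Rinv_1. apply Rinv_le_contravar; lra. }
  assert (h1 : Rpower 2 (1 / p) < 1 + 1 / p).
  { assert (h := Rpower_bernoulli_lt 1 (1 / p) ltac:(lra) ltac:(lra) hip).
    replace (1 + 1) with 2 in h by ring. lra. }
  assert (h2 : Rpower 2 (/ (p - 1)) <= p / (p - 1)).
  { assert (h := Rpower_bernoulli_le 1 (/ (p - 1)) ltac:(lra) hiq).
    replace (1 + 1) with 2 in h by ring.
    replace (p / (p - 1)) with (1 + / (p - 1) * 1) by (field; lra). exact h. }
  assert (h3 : 2 <= Rpower (p / (p - 1)) (p - 1)).
  { assert (h := Rle_Rpower_l _ _ (p - 1) ltac:(lra) (conj (Rpower_pos _ _) h2)).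
    rewrite Rpower_mult, Rinv_l, Rpower_1 in h by lra. exact h. }
  assert (hr : 0 < p / (p - 1)) by (apply Rdiv_lt_0_compat; lra).
  assert (e1 : Rpower (p / (p - 1)) p = Rpower (p / (p - 1)) (p - 1) * (p / (p - 1))).
  { rewrite <- (Rpower_1 (p / (p - 1))) at 3 by exact hr.
    rewrite <- Rpower_plus. f_equal. ring. }
  assert (e2 : Rpower 2 (- ((p - 1) / p)) = Rpower 2 (1 / p) / 2).
  { replace (- ((p - 1) / p)) with (1 / p + - (1)) by (field; lra).
    rewrite Rpower_plus, Rpower_Ropp, Rpower_1 by lra. reflexivity. }
  rewrite e1, e2.
  assert (h4 : (1 - 1 / p) / 2 < 1 - Rpower 2 (1 / p) / 2) by lra.
  assert (e3 : p / (p - 1) * (1 - 1 / p) = 1) by (field; lra).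
  set (B := 1 - Rpower 2 (1 / p) / 2) in *.
  assert (h5 : 1 / 2 < p / (p - 1) * B) by nra.
  rewrite Rmult_assoc. nra.
Qed.

(** The base on the left is the integral bound for the sum. The two sides are separated by
    [(P / a * exp (- E / (p - 1)))^(p-1)]. *)
Lemma Rpower_factor_bound (p N : R) :
  3 <= p -> 2 <= N ->
  let a := (p - 1) / p in
  Rpower ((Rpower N a - 1 / p) / a) (p - 1)
  < Rpower (p / (p - 1)) p * Rpower N p * (Rpower N (- a) - Rpower (N + 1) (- a)).
Proof.
  intros hp hN a.
  assert (hs : 0 < 1 / p <= 1 / 3).
  { split; [apply Rdiv_lt_0_compat; lra|].
    unfold Rdiv. rewrite !Rmult_1_l. apply Rinv_le_contravar; lra. }
  assert (ea : a = 1 - 1 / p) by (unfold a; field; lra).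
  set (s := 1 / p) in *.
  assert (ha : 0 < a) by lra.
  set (P := Rpower N a).
  assert (hP1 : 1 < P).
  { unfold P. rewrite <- (Rpower_O N) by lra. apply Rpower_lt; lra. }
  set (E := (a + 1) * / N / 2).
  assert (hr : p / (p - 1) = / a) by (unfold a; field; lra).
  assert (hNi : 0 < / N) by (apply Rinv_0_lt_compat; lra).
  (* By [e^y >= 1 + y] it suffices that [E / (p - 1) < s / P]; multiplying by [N / s] turns this
     into [(2 - s) / (2 (1 - s)) < N^s]. *)
  assert (hstrict : 1 - s * / P < exp (- (E * / (p - 1)))).
  { eapply Rlt_le_trans; [|apply exp_ineq1_le].
    assert (hNs : (2 - s) / (2 * (1 - s)) < Rpower N s).
    { eapply Rlt_le_trans; [apply Rpower_2_gt; lra|].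
      apply Rle_Rpower_l; lra. }
    assert (e1 : / P = Rpower N s * / N).
    { unfold P. rewrite <- Rpower_Ropp, ea.
      replace (- (1 - s)) with (s + - (1)) by ring.
      rewrite Rpower_plus, (Rpower_Ropp N 1), Rpower_1 by lra. reflexivity. }
    assert (e2 : E * / (p - 1) = s * ((2 - s) / (2 * (1 - s)) * / N)).
    { unfold E, s, a. field. lra. }
    rewrite e1, e2.
    assert ((2 - s) / (2 * (1 - s)) * / N < Rpower N s * / N)
      by (apply Rmult_lt_compat_r; assumption).
    nra. }
  assert (hlow := one_minus_Rpower_ge a (/ N) ha hNi). fold E in hlow.
  apply Rlt_le_trans with (Rpower (P / a * exp (- (E * / (p - 1)))) (p - 1)).
  - apply Rlt_Rpower_l; [lra|].
    replace ((P - s) / a) with (P / a * (1 - s * / P)) by (field; lra).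
    assert (hPa : 0 < P / a) by (apply Rdiv_lt_0_compat; lra).
    assert (/ P < 1) by (rewrite <- Rinv_1; apply Rinv_lt_contravar; lra).
    assert (0 < / P) by (apply Rinv_0_lt_compat; lra).
    split; [apply Rmult_lt_0_compat; nra|].
    apply Rmult_lt_compat_l; assumption.
  - assert (eE : Rpower (exp (- (E * / (p - 1)))) (p - 1) = exp (- E)).
    { unfold Rpower. rewrite ln_exp. f_equal. field. lra. }
    assert (eN : Rpower (N + 1) (- a) = / P * Rpower (1 + / N) (- a)).
    { unfold P. rewrite <- Rpower_Ropp, Rpower_mult_distr by lra.
      f_equal. field. lra. }
    (* Since [a * p = p - 1], both sides are [N^(p-1)]. *)
    assert (ePN : Rpower P (p - 1) * P = Rpower N p * / N).
    { unfold P. rewrite Rpower_mult, <- Rpower_plus.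
      replace (/ N) with (Rpower N (- (1)))
        by (rewrite (Rpower_Ropp N 1), Rpower_1 by lra; reflexivity).
      rewrite <- Rpower_plus. f_equal. unfold a. field. lra. }
    assert (eA : Rpower (/ a) p = Rpower (/ a) (p - 1) * / a).
    { assert (0 < / a) by (apply Rinv_0_lt_compat; lra).
      rewrite <- (Rpower_1 (/ a)) at 3 by assumption.
      rewrite <- Rpower_plus. f_equal. ring. }
    assert (hia : 0 < / a) by (apply Rinv_0_lt_compat; lra).
    unfold Rdiv at 1.
    rewrite <- !Rpower_mult_distr; try apply exp_pos; try lra;
      try (apply Rmult_lt_0_compat; lra).
    rewrite eE, hr, eA, eN, (Rpower_Ropp N a). fold P.
    set (Q := Rpower P (p - 1)) in *.
    set (A := Rpower (/ a) (p - 1)).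
    set (W := Rpower (1 + / N) (- a)) in *.
    assert (hQ : 0 < Q) by apply Rpower_pos.
    assert (hA : 0 < A) by apply Rpower_pos.
    assert (eNp : Rpower N p = Q * P * N) by (rewrite ePN; field; lra).
    rewrite eNp.
    (* Once [Q * A] is cancelled, what remains is [hlow] multiplied by [N / a]. *)
    replace (A * / a * (Q * P * N) * (/ P - / P * W))
      with (Q * A * (/ a * N * (1 - W))) by (field; lra).
    apply Rmult_le_compat_l; [nra|].
    replace (exp (- E)) with (/ a * N * (a * / N * exp (- E))) by (field; lra).
    apply Rmult_le_compat_l; [nra | exact hlow].
Qed.

Theorem mainTheorem4 (p : R) (n : nat) (hp : 3 <= p) (hn : (1 <= n)%nat) :
  Rpower (sum_f 1 n (fun i : nat => Rpower (INR i) (- (1 / p)))) (p - 1)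
  < Rpower (p / (p - 1)) p * Rpower (INR n) p
    * (Rpower (INR n) (- ((p - 1) / p)) - Rpower (INR (n + 1)) (- ((p - 1) / p))).
Proof.
  assert (one : forall y, Rpower 1 y = 1)
    by (intro y; unfold Rpower; rewrite ln_1, Rmult_0_r; apply exp_0).
  unfold sum_f.
  destruct (Nat.eq_dec n 1) as [->|hn1].
  { simpl. replace (1 + 1) with 2 by ring. rewrite !one, Rmult_1_r.
    apply Rpower_one_minus_inv_lt; exact hp. }
  assert (hN : 2 <= INR n).
  { change 2 with (INR 2). apply le_INR. lia. }
  assert (hs : 0 < 1 / p < 1).
  { split; [apply Rdiv_lt_0_compat; lra|]. apply (proj1 (Rdiv_lt_1 1 p ltac:(lra))). lra. }
  eapply Rle_lt_trans;
    [| rewrite plus_INR; apply (Rpower_factor_bound p (INR n) hp hN)].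
  apply Rle_Rpower_l; [lra|]. split.
  (* Monotonicity of the power needs a positive base; splitting off the last term gives strict
     positivity. *)
  - replace (n - 1)%nat with (S (n - 2)) by lia.
    rewrite tech5. apply Rplus_le_lt_0_compat; [|apply Rpower_pos].
    apply cond_pos_sum. intro k. left. apply Rpower_pos.
  (* [sum_f 1 n] unfolds to a sum over indices [0] to [n - 1] with argument shifted by [1], hence
     [m = n - 1]. *)
  - assert (h := sum_Rpower_le (1 / p) (n - 1) hs).
    replace (n - 1 + 1)%nat with n in h by lia.
    replace ((p - 1) / p) with (1 - 1 / p) by (field; lra).
    exact h.
Qed.
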